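(* Let $f\colon\mathbb{R}\times\mathbb{R}^n\to\mathbb{R}^n$ be smooth, and consider $\dot{x}(t)=f(t,x(t))$ with initial set $\mathcal{X}=B_{M_0}([x_0],\delta_0)$ at time $t_0$. Assume that the rigorous tool used by the algorithm CLRT (described in the context) produces conservative gradient enclosures, and that the algorithm terminates on the provided inputs. Let $[t_0,T]$ be the whole time interval, traversed by CLRT in $k$ steps at times $t_0<t_1<\dots<t_k=T$. Then the output of CLRT is a reachtube over-approximation for all times in $[t_0,T]$, i.e. $$\mathrm{Reach}\big((t_0,\mathcal{X}),[t_j,t_{j+1}]\big)\subset B_{M_j}([x_j],\Delta_j)\qquad\text{for } j=0,\dots,k-1.$$
   Context: For symmetric positive definite $M$, $\|x\|_M=\sqrt{x^TMx}$, and $B_M(x,r)=\{y:\|y-x\|_M\le r\}$. $[x]$ denotes a box (product of compact intervals) in $\mathbb{R}^n$, and $B_M([x],r)=\bigcup_{x\in[x]}B_M(x,r)$. $\chi_{s}^{t}(x)$ is the value at time $t$ of the solution of $\dot x=f(t,x)$ that equals $x$ at time $s$, and $\nabla_x\chi_s^t(x)$ is its derivative in $x$. $\mathrm{Reach}((t_0,\mathcal{X}),[a,b])=\{\chi_{t_0}^{t}(x):x\in\mathcal{X},\,t\in[a,b]\}$. A compact set $\mathcal{F}\subset\mathbb{R}^{n\times n}$ is a conservative gradient enclosure for a set $\mathcal{Y}$ from time $s$ to time $t$ if $\nabla_x\chi_s^t(x)\in\mathcal{F}$ for all $x\in\mathcal{Y}$ (in particular $\chi_s^t$ is defined on $\mathcal{Y}$).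 The algorithm CLRT has as input $t_0$, $T$, an initial time increment $h>0$, a symmetric positive definite $M_0$, a box $[x_0]$, a radius $\delta_0>0$, and parameters $\varepsilon_{IST}>0$, $C_\delta>1$, $C_M>0$. Given the data $t_j,[x_j],M_j,\delta_j$, with $M_j=A_j^TA_j$, step $j$ ($j=0,1,\dots$) proceeds as follows. (1) Halve $h$ until the computed enclosure of the displacement gradient $\nabla_x\chi_{t_j}^{t_j+h}(x)-I$ over $x\in B_{M_j}([x_j],\delta_j)$ has norm less than $\varepsilon_{IST}$; set $t_{j+1}=t_j+h$. (2) Compute a box $[x_{j+1}]$ containing $\chi_{t_j}^{t_{j+1}}([x_j])$, and a conservative gradient enclosure $\mathcal{F}_j$ for $B_{M_j}([x_j],\delta_j)$ from time $t_j$ to $t_{j+1}$. Let $F$ be the midpoint of an enclosure of $\nabla_x\chi_{t_j}^{t_{j+1}}$ on $[x_j]$, and let $\hat{M}=\hat{A}^T\hat{A}$, where $\hat{A}$ is the real form of the inverse of the matrix of normalized eigenvectors of $F$ (a real invertible matrix such that $\hat{A}F\hat{A}^{-1}$ is block-diagonal with blocks of size at most two, $2\times 2$ blocks corresponding to complex conjugate eigenvalue pairs). For $M=A^TA$, the $M$-stretching factor is $\|AFA^{-1}\|_2$. If the $M_j$-stretching factor exceeds $C_M$ times the $\hat{M}$-stretching factor, set $M_{j+1}=\hat{M}$; otherwise set $M_{j+1}=M_j$. Write $M_{j+1}=A_{j+1}^TA_{j+1}$. Compute $\Lambda_j>0$ with $\Lambda_j\ge\|A_{j+1}GA_j^{-1}\|_2$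 for all $G\in\mathcal{F}_j$, and set $\delta_{j+1}=\Lambda_j\delta_j$. (3) Choose an initial guess $\tilde\delta>0$ (an approximate maximum of $\|h f(t_j+s,x)\|_{M_j}$ over a ball $B_{M_j}([x_j],C_\delta\delta_j)$ and $s\in[0,h]$, obtained by convex optimization) and set $\hat\Delta=\delta_j+\tilde\delta$. Query a sound decision procedure on the formula $$\exists\, x\in B_{M_j}([x_j],\hat\Delta)\ \exists\, s\in[0,h]:\ \|h\cdot f(t_j+s,x)\|_{M_j}>\hat\Delta-\delta_j .$$ Sound means that if it answers UNSAT then the formula is false. While the answer is not UNSAT, replace $\tilde\delta$ by $C_\delta\tilde\delta$ and $\hat\Delta$ by $\delta_j+\tilde\delta$ and query again. When the answer is UNSAT, set $\Delta_j=\hat\Delta$. Output $[x_j],M_j,\Delta_j$. If $t_{j+1}\ge T$, terminate; otherwise proceed to step $j+1$ with the data $t_{j+1},[x_{j+1}],M_{j+1},\delta_{j+1}$. *)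

(* Defs.v *)
From HB Require Import structures.
From mathcomp Require Import all_boot all_order all_algebra.
From mathcomp Require Import all_classical all_reals all_analysis.
From mathcomp Require Import complex.

Set Implicit Arguments.
Unset Strict Implicit.
Unset Printing Implicit Defensive.

Import Order.TTheory GRing.Theory Num.Theory.
Import numFieldNormedType.Exports.

Local Open Scope classical_set_scope.
Local Open Scope ring_scope.

Section Smooth.
Context {R : realType} {U W : normedModType R}.

(* [Ck k g]: g is k times continuously differentiable on the whole of U. *)
Fixpoint Ck (k : nat) (g : U -> W) : Prop :=
  if k is k'.+1 then
    (forall x, differentiable g x) /\ (forall v, Ck k' ('D_v g))
  else continuous g.

Definition smooth (g : U -> W) : Prop := forall k, Ck k g.

End Smooth.

Section Metric.
Context {R : realType} {n : nat}.
Implicit Types (M A F : 'M[R]_n) (x y : 'cV[R]_n) (X : set 'cV[R]_n)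
  (E : set 'M[R]_n).

Definition qform M x : R := (x^T *m M *m x) ord0 ord0.

Definition sym_posdef M : Prop :=
  M^T = M /\ (forall x, x != 0 -> 0 < qform M x).

Definition mnorm M x : R := Num.sqrt (qform M x).

(* The Euclidean norm; the norm that the library puts on matrices is the
   maximum norm, which is used here only for its topology. *)
Definition norm2 x : R := mnorm 1%:M x.

Definition opnorm2 A : R := sup [set norm2 (A *m x) | x in [set x | norm2 x <= 1]].

Definition mball M x (r : R) : set 'cV[R]_n := [set y | mnorm M (y - x) <= r].

Definition mtube M X (r : R) : set 'cV[R]_n := \bigcup_(x in X) mball M x r.

Definition is_box X : Prop :=
  exists lo hi : 'cV[R]_n, (forall i, lo i ord0 <= hi i ord0) /\
    X = [set x | forall i, lo i ord0 <= x i ord0 <= hi i ord0].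

Definition set_opnorm2 E : R := sup (opnorm2 @` E).

(* The midpoint of the interval hull of E, hence the usual midpoint when E is
   an interval matrix. *)
Definition midpoint E : 'M[R]_n :=
  \matrix_(i, j) ((inf [set G i j | G in E] + sup [set G i j | G in E]) / 2).

(* The stretching factor of F in the metric A^T A; it depends on A only through
   A^T A. *)
Definition stretching A F : R := opnorm2 (A *m F *m invmx A).

Local Open Scope complex_scope.

(* A is the real form of the inverse of a matrix V of normalized eigenvectors of
   F: the columns of A^-1 are those of V, except that two (adjacent) columns v
   and conj v for a pair of non-real conjugate eigenvalues are replaced by Re v
   and Im v. *)
Definition real_eigenform F A : Prop :=
  A \in unitmx /\
  exists (V : 'M[R[i]]_n) (lam : 'I_n -> R[i]),
  let realcol (j : 'I_n) :=
    complex.Im (lam j) = 0 /\ (forall i, V i j = (invmx A i j)%:C) in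
  let pair (j j' : 'I_n) :=
    [/\ j' = j.+1 :> nat,
        complex.Im (lam j) != 0 /\ lam j' = conjc (lam j),
        forall i, V i j' = conjc (V i j),
        forall i, invmx A i j = complex.Re (V i j) &
        forall i, invmx A i j' = complex.Im (V i j)] in
  [/\ V \in unitmx,
      forall j, map_mx (real_complex R) F *m col j V = lam j *: col j V,
      forall j, \sum_i `|V i j| ^+ 2 = 1 &
      forall j, [\/ realcol j, exists j', pair j j' | exists j', pair j' j]].

End Metric.

Section Flow.
Context {R : realType} {n : nat}.
Implicit Types (f : R -> 'cV[R]_n -> 'cV[R]_n) (s t : R) (x y : 'cV[R]_n)
  (Y : set 'cV[R]_n) (E : set 'M[R]_n).

(* u solves x' = f (t, x) between s and t, in either order. Requiring two-sided
   derivatives at the end points is harmless: u is unconstrained outside the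
   interval, so it can be continued there along its tangents. *)
Definition solution f s t (u : R -> 'cV[R]_n) : Prop :=
  forall r, Num.min s t <= r <= Num.max s t -> is_derive r 1 u (f r (u r)).

Definition flow_to f s t x y : Prop :=
  exists u, [/\ solution f s t u, u s = x & u t = y].

Definition flow_defined f s t x : Prop := exists y, flow_to f s t x y.

(* The flow map chi_s^t. It takes the arbitrary value 0 at the points from which
   the solution does not exist up to time t. *)
Definition flow f s t x : 'cV[R]_n := xget 0 [set y | flow_to f s t x y].

Definition reach f t0 Y (a b : R) : set 'cV[R]_n :=
  [set y | exists x t, [/\ Y x, a <= t <= b & y = flow f t0 t x]].

(* [is_diff x g (mulmx G)]: the derivative of g at x exists and has the Jacobian
   matrix G (acting on column vectors). For smooth f the domain of chi_s^t is
   open, so the default value used by [flow] does not affect the derivative. *)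
Definition conservative_enclosure f s t Y E : Prop :=
  compact E /\ (forall x, Y x -> flow_defined f s t x /\
    exists2 G, E G & is_diff x (flow f s t) (mulmx G)).

End Flow.

Section CLRT.
Context {R : realType} {n : nat}.
Implicit Types (f : R -> 'cV[R]_n -> 'cV[R]_n).

(* The formula
     exists x in B_M(X, rho), exists s in [0, h],
       || h f (t + s, x) ||_M > rho - delta. *)
Record query := Query {
  q_time : R;
  q_incr : R;
  q_box : set 'cV[R]_n;
  q_metric : 'M[R]_n;
  q_delta : R;
  q_radius : R }.

Definition query_holds f (q : query) : Prop :=
  exists x s, [/\ mtube (q_metric q) (q_box q) (q_radius q) x,
    0 <= s <= q_incr q &
    q_radius q - q_delta q <
      mnorm (q_metric q) (q_incr q *: f (q_time q + s) x)].

Inductive answer := UNSAT | OTHER.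

(* The external tools, as relations between a call and its possible results, so
   that they may be partial or non-deterministic. [grad_tool s t Y] returns
   enclosures of the gradient of the flow from s to t on Y. [disp_tool s t Y]
   returns enclosures of this gradient minus the identity, or None when no
   enclosure is found. *)
Record clrt_tools := ClrtTools {
  grad_tool : R -> R -> set 'cV[R]_n -> set 'M[R]_n -> Prop;
  disp_tool : R -> R -> set 'cV[R]_n -> option (set 'M[R]_n) -> Prop;
  solver : query -> answer -> Prop }.

Definition tools_conservative f (tl : clrt_tools) : Prop :=
  (forall s t Y E, grad_tool tl s t Y E -> conservative_enclosure f s t Y E) /\
  (forall s t Y E, disp_tool tl s t Y (Some E) ->
     conservative_enclosure f s t Y [set 1%:M + D | D in E]).

Definition solver_sound f (tl : clrt_tools) : Prop :=
  forall q, solver tl q UNSAT -> ~ query_holds f q.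

(* The data at the beginning of a step; [incr] is the current value of the
   variable h, so that step j uses the increment stored in the data of step
   j + 1, and [factor] is a matrix A with metric = A^T A. *)
Record clrt_data := ClrtData {
  time : R;
  incr : R;
  box : set 'cV[R]_n;
  metric : 'M[R]_n;
  factor : 'M[R]_n;
  radius : R }.

Definition data_tube (d : clrt_data) : set 'cV[R]_n :=
  mtube (metric d) (box d) (radius d).

Definition accept_incr (tl : clrt_tools) (eps : R) (d : clrt_data) (h : R) :=
  exists2 E, disp_tool tl (time d) (time d + h) (data_tube d) (Some E) &
    set_opnorm2 E < eps.

Definition reject_incr (tl : clrt_tools) (eps : R) (d : clrt_data) (h : R) :=
  exists2 o, disp_tool tl (time d) (time d + h) (data_tube d) o &
    if o is Some E then eps <= set_opnorm2 E else True.

Definition step_time (tl : clrt_tools) (eps : R) (d d' : clrt_data) : Prop :=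
  exists m : nat,
  [/\ forall i, (i < m)%N -> reject_incr tl eps d (incr d / 2 ^+ i),
      accept_incr tl eps d (incr d / 2 ^+ m),
      incr d' = incr d / 2 ^+ m & time d' = time d + incr d'].

Definition step_tube f (tl : clrt_tools) (CM : R) (d d' : clrt_data) : Prop :=
  exists (Fj E : set 'M[R]_n) (Ahat : 'M[R]_n) (Lambda : R),
  let F := midpoint E in
  [/\ is_box (box d') /\ flow f (time d) (time d') @` box d `<=` box d',
      grad_tool tl (time d) (time d') (data_tube d) Fj,
      grad_tool tl (time d) (time d') (box d) E /\ real_eigenform F Ahat,
      metric d' = (if CM * stretching Ahat F < stretching (factor d) F
                   then Ahat^T *m Ahat else metric d) /\
      metric d' = (factor d')^T *m factor d' &
      [/\ 0 < Lambda,
          forall G, Fj G ->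
            opnorm2 (factor d' *m G *m invmx (factor d)) <= Lambda &
          radius d' = Lambda * radius d]].

(* The initial guess is an arbitrary positive number, as no accuracy is claimed
   for the optimization that produces it. *)
Definition step_output (tl : clrt_tools) (Cdelta : R) (d d' : clrt_data)
    (Delta : R) : Prop :=
  exists (guess : R) (m : nat),
  let radius_at i := radius d + Cdelta ^+ i * guess in
  let query_at i :=
    Query (time d) (incr d') (box d) (metric d) (radius d) (radius_at i) in
  [/\ 0 < guess,
      forall i, (i < m)%N -> solver tl (query_at i) OTHER,
      solver tl (query_at m) UNSAT & Delta = radius_at m].

Definition clrt_step f (tl : clrt_tools) (eps Cdelta CM : R)
    (d d' : clrt_data) (Delta : R) : Prop :=
  [/\ step_time tl eps d d', step_tube f tl CM d d' &
      step_output tl Cdelta d d' Delta].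

(* A terminating execution with k steps; step j goes from [d j] to [d j.+1] and
   outputs box (d j), metric (d j) and Delta j. *)
Definition clrt_run f (tl : clrt_tools) (eps Cdelta CM : R)
    (t0 T h0 : R) (M0 : 'M[R]_n) (X0 : set 'cV[R]_n) (delta0 : R)
    (k : nat) (d : nat -> clrt_data) (Delta : nat -> R) : Prop :=
  [/\ [/\ time (d 0%N) = t0, incr (d 0%N) = h0, box (d 0%N) = X0 &
          radius (d 0%N) = delta0],
      metric (d 0%N) = M0 /\ M0 = (factor (d 0%N))^T *m factor (d 0%N),
      forall j, (j < k)%N ->
        clrt_step f tl eps Cdelta CM (d j) (d j.+1) (Delta j),
      (0 < k)%N /\ (forall j, (j.+1 < k)%N -> time (d j.+1) < T) &
      T <= time (d k)].

End CLRT.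

Arguments query : clear implicits.
Arguments clrt_tools : clear implicits.
Arguments clrt_data : clear implicits.

(* Main.v *)
(* Two facts carry the proof. First, by the mean value inequality along the
   segment from x to y, which stays in B_M(x, delta), the flow over step j
   expands the distance between x and y, measured by M_j before the step and by
   M_(j+1) after it, by at most the factor Lambda_j; hence, by induction on j,
   the solutions started in X are in B_(M_j)([x_j], delta_j) at time t_j. This
   uses that solutions compose, and so the uniqueness of solutions, which is
   Gronwall's inequality with a Lipschitz constant taken on the compact set of
   the segments joining the two solutions. Second, the answer UNSAT bounds the
   M_j-norm of h f by Delta_j - delta_j inside B_(M_j)([x_j], Delta_j), so a
   solution cannot leave this set before the time h has elapsed. *)
Require Import Defs.
From HB Require Import structures.
From mathcomp Require Import all_boot all_order all_algebra.
From mathcomp Require Import all_classical all_reals all_analysis.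
From mathcomp Require Import ring lra.
Import Order.TTheory GRing.Theory Num.Theory.
Import numFieldNormedType.Exports.
Local Open Scope classical_set_scope.
Local Open Scope ring_scope.

(** * The Euclidean norm and the spectral norm *)

Section Euclidean.
Context {R : realType} {n : nat}.
Implicit Types (A : 'M[R]_n) (x y : 'cV[R]_n).

Definition dot x y : R := \sum_i x i ord0 * y i ord0.

Lemma dot_mx x y : (x^T *m y) ord0 ord0 = dot x y.
Proof. by rewrite mxE; apply: eq_bigr => i _; rewrite mxE. Qed.

Lemma dotC x y : dot x y = dot y x.
Proof. by apply: eq_bigr => i _; rewrite mulrC. Qed.

Lemma dotDr x y z : dot x (y + z) = dot x y + dot x z.
Proof. by rewrite -big_split; apply: eq_bigr => i _; rewrite mxE mulrDr. Qed.

Lemma dotZr a x y : dot x (a *: y) = a * dot x y.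
Proof. by rewrite mulr_sumr; apply: eq_bigr => i _; rewrite mxE; ring. Qed.

Lemma dotBr x y z : dot x (y - z) = dot x y - dot x z.
Proof. by rewrite -scaleN1r dotDr dotZr mulN1r. Qed.

Lemma dotxx_ge0 x : 0 <= dot x x.
Proof. by apply: sumr_ge0 => i _; rewrite -expr2 sqr_ge0. Qed.

Lemma dotxx_eq0 x : dot x x = 0 -> x = 0.
Proof.
move=> x0; apply/colP => i; rewrite mxE; apply/eqP; rewrite -sqrf_eq0 expr2.
move/eqP: x0; rewrite psumr_eq0; last by move=> j _; rewrite -expr2 sqr_ge0.
by move/allP/(_ i); rewrite mem_index_enum => /(_ isT).
Qed.

Lemma norm2E x : norm2 x = Num.sqrt (dot x x).
Proof. by rewrite /norm2 /mnorm /qform mulmx1 dot_mx. Qed.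

Lemma norm2_ge0 x : 0 <= norm2 x.
Proof. by rewrite norm2E sqrtr_ge0. Qed.

Lemma sqr_norm2 x : norm2 x ^+ 2 = dot x x.
Proof. by rewrite norm2E sqr_sqrtr ?dotxx_ge0. Qed.

Lemma norm2_eq0 x : norm2 x = 0 -> x = 0.
Proof. by move=> x0; apply: dotxx_eq0; rewrite -sqr_norm2 x0 expr0n. Qed.

Lemma norm2Z a x : norm2 (a *: x) = `|a| * norm2 x.
Proof.
rewrite !norm2E dotZr dotC dotZr mulrA -expr2 sqrtrM ?sqr_ge0 //.
by rewrite sqrtr_sqr.
Qed.

Lemma norm20 : norm2 (0 : 'cV[R]_n) = 0.
Proof. by rewrite -(scale0r (0 : 'cV[R]_n)) norm2Z normr0 mul0r. Qed.

(** Cauchy-Schwarz: the vector [dot y y *: x - dot x y *: y] has a non-negative square, from which a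
    factor [dot y y] splits off. *)
Lemma dot_le_norm2 x y : dot x y <= norm2 x * norm2 y.
Proof.
have [y0|ny0] := eqVneq (dot y y) 0.
  rewrite (dotxx_eq0 _ y0) norm20 mulr0 /dot big1 // => i _.
  by rewrite mxE mulr0.
have yy : 0 < dot y y by rewrite lt_def ny0 dotxx_ge0.
apply: le_trans (ler_norm _) _.
rewrite -(@ler_pXn2r _ 2) ?nnegrE ?mulr_ge0 ?norm2_ge0 //.
rewrite real_normK ?num_real // exprMn !sqr_norm2.
have := dotxx_ge0 (dot y y *: x + (- dot x y) *: y).
rewrite !(dotDr, dotZr) !(dotC (_ + _)) !(dotDr, dotZr) (dotC y x) => h.
suff : 0 <= dot y y * (dot x x * dot y y - dot x y ^+ 2).
  by rewrite pmulr_rge0 // subr_ge0.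
apply: le_trans h _; rewrite le_eqVlt; apply/orP; left; apply/eqP; ring.
Qed.

Lemma norm2D x y : norm2 (x + y) <= norm2 x + norm2 y.
Proof.
rewrite -(@ler_pXn2r _ 2) ?nnegrE ?addr_ge0 ?norm2_ge0 //.
rewrite sqrrD !sqr_norm2 dotDr !(dotC (_ + _)) !dotDr (dotC y x).
by have := dot_le_norm2 x y; lra.
Qed.

Lemma coord_le_norm2 x i : `|x i ord0| <= norm2 x.
Proof.
rewrite -(@ler_pXn2r _ 2) ?nnegrE ?norm2_ge0 // real_normK ?num_real //.
rewrite sqr_norm2 /dot (bigD1 i) //= -expr2 lerDl.
by apply: sumr_ge0 => j _; rewrite -expr2 sqr_ge0.
Qed.

Lemma norm2_le_sum x : norm2 x <= \sum_i `|x i ord0|.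
Proof.
have s0 : 0 <= \sum_i `|x i ord0| by apply: sumr_ge0.
rewrite -(@ler_pXn2r _ 2) ?nnegrE ?norm2_ge0 // sqr_norm2 expr2 mulr_suml.
apply: ler_sum => i _; rewrite (le_trans (ler_norm _)) // normrM.
by apply: ler_wpM2l => //; rewrite (bigD1 i) //= lerDl; apply: sumr_ge0.
Qed.

(** A crude bound, serving to make the supremum in [opnorm2] finite and to bound Jacobians in
    [segment_lipschitz]. *)
Lemma norm2_mulmx_entries A B x : (forall i j, `|A i j| <= B) ->
  norm2 (A *m x) <= n%:R * (n%:R * B) * norm2 x.
Proof.
move=> AB; apply: le_trans (norm2_le_sum _) _.
have h i : `|(A *m x) i ord0| <= n%:R * B * norm2 x.
  rewrite mxE (le_trans (ler_norm_sum _ _ _)) //.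
  apply: (@le_trans _ _ (\sum_(j < n) B * norm2 x)).
    by apply: ler_sum => j _; rewrite normrM ler_pM ?coord_le_norm2.
  by rewrite sumr_const card_ord -(mulr_natl (B * _)) mulrA.
apply: (@le_trans _ _ (\sum_(i < n) n%:R * B * norm2 x)).
  by apply: ler_sum => i _; exact: h.
by rewrite sumr_const card_ord -(mulr_natl (_ * norm2 x)) !mulrA.
Qed.

Lemma norm2_mulmx_le A x : norm2 (A *m x) <= opnorm2 A * norm2 x.
Proof.
have [x0|nx0] := eqVneq (norm2 x) 0.
  by rewrite (norm2_eq0 _ x0) mulmx0 norm20 mulr0.
have xp : 0 < norm2 x by rewrite lt_def nx0 norm2_ge0.
rewrite -ler_pdivrMr // -[leLHS]ger0_norm ?divr_ge0 ?norm2_ge0 //.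
have -> : `|norm2 (A *m x) / norm2 x| = norm2 (A *m ((norm2 x)^-1 *: x)).
  rewrite -scalemxAr norm2Z ger0_norm ?divr_ge0 ?norm2_ge0 //.
  by rewrite ger0_norm ?invr_ge0 ?norm2_ge0 // mulrC.
apply: ub_le_sup; last first.
  exists ((norm2 x)^-1 *: x) => //=.
  by rewrite norm2Z ger0_norm ?invr_ge0 ?norm2_ge0 // mulVf.
(* [sup] bounds its set only if the set is bounded above. The sum of the absolute values of all
   entries of [A] gives such a bound through [norm2_mulmx_entries]. *)
pose B := \sum_i \sum_j `|A i j|.
have B0 : 0 <= B by apply: sumr_ge0 => i _; apply: sumr_ge0.
exists (n%:R * (n%:R * B)) => _ [z /= z1 <-].
apply: le_trans (norm2_mulmx_entries _ B _ _) _ => [i j|].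
  rewrite /B (bigD1 i) //= (bigD1 j) //= -addrA lerDl addr_ge0 //.
    by apply: sumr_ge0.
  by apply: sumr_ge0 => k _; apply: sumr_ge0.
by rewrite -[leRHS]mulr1 ler_wpM2l // !mulr_ge0.
Qed.

(** Turns estimates in the metric into Euclidean ones, to which [opnorm2] applies. *)
Lemma mnorm_factor A x : mnorm (A^T *m A) x = norm2 (A *m x).
Proof.
by rewrite norm2E -dot_mx trmx_mul /mnorm /qform !mulmxA.
Qed.

End Euclidean.

(** * Mean value inequalities *)

Section Calculus.
Context {R : realType} {n : nat}.
Implicit Types (u v : R -> 'cV[R]_n) (t : R) (du : 'cV[R]_n).

Lemma is_derive_coord u t du i : is_derive t 1 u du ->
  is_derive t (1 : R) (fun r => u r i ord0) (du i ord0).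
Proof.
move=> [ud <-]; apply: DeriveDef; first exact: (derivable_mxP _ _ _).1.
by rewrite derive_mx // mxE.
Qed.

Lemma is_derive_dot (c : 'cV[R]_n) u t du : is_derive t 1 u du ->
  is_derive t (1 : R) (fun r => dot c (u r)) (dot c du).
Proof.
move=> ud.
have -> : (fun r => dot c (u r)) =
    \sum_(i < n) (fun r : R => c i ord0 *: u r i ord0 : R).
  by apply/funext => r; rewrite fct_sumE.
apply: is_derive_sum => i.
by have := @is_deriveZ _ _ _ _ (c i ord0) _ _ _ (is_derive_coord _ _ _ i ud).
Qed.

Lemma is_derive_dotxx u t du : is_derive t 1 u du ->
  is_derive t (1 : R) (fun r => dot (u r) (u r)) (2 * dot (u t) du).
Proof.
move=> ud.
have -> : (fun r => dot (u r) (u r)) =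
    \sum_(i < n) ((fun r : R => u r i ord0) * (fun r : R => u r i ord0)).
  by apply/funext => r; rewrite fct_sumE.
have ui i := is_derive_coord u t du i ud.
have h i := is_deriveM (ui i) (ui i).
apply: (is_derive_eq (is_derive_sum h)).
rewrite mulr_sumr; apply: eq_bigr => i _.
rewrite /GRing.scale /=; ring.
Qed.

Lemma is_derive1_continuous (V : normedModType R) (u : R -> V) t (du : V) :
  is_derive t 1 u du -> {for t, continuous u}.
Proof.
by move=> [ud _]; apply/differentiable_continuous/derivable1_diffP.
Qed.

Lemma derive1_within_continuous (V : normedModType R) (u du : R -> V) (a b : R) :
  (forall t, a <= t <= b -> is_derive t 1 u (du t)) ->
  {within `[a, b], continuous u}.
Proof.
move=> ud; apply: derivable_within_continuous => t.
by rewrite in_itv => /ud [].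
Qed.

Lemma is_derive_mulmx (A : 'M[R]_n) u t du : is_derive t 1 u du ->
  is_derive t 1 (fun r => A *m u r) (A *m du).
Proof.
move=> ud.
have AuE i (x : 'cV[R]_n) : (A *m x) i ord0 = dot ((row i A)^T) x.
  by rewrite mxE; apply: eq_bigr => j _; rewrite !mxE.
have Aud i : is_derive t (1 : R) (fun r => (A *m u r) i ord0)
    ((A *m du) i ord0).
  under eq_fun do rewrite AuE.
  by rewrite AuE; exact: is_derive_dot.
have Ad : derivable (fun r => A *m u r) t 1.
  by apply/derivable_mxP => i j; rewrite ord1; case: (Aud i).
apply: DeriveDef => //; rewrite derive_mx //.
by apply/colP => i; rewrite mxE; case: (Aud i).
Qed.

(** The scalar mean value theorem applies to [dot w (u r)] with the fixed vector [w = u b - u a];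
    Cauchy-Schwarz then allows division by [norm2 w]. Bounding the speed only inside the interval
    lets [norm2_barrier] argue up to a first hitting time. *)
Lemma norm2_mvt u (du : R -> 'cV[R]_n) (a b c : R) : a <= b ->
  (forall t, a <= t <= b -> is_derive t 1 u (du t)) ->
  (forall t, a < t < b -> norm2 (du t) <= c) ->
  norm2 (u b - u a) <= c * (b - a).
Proof.
rewrite le_eqVlt => /orP[/eqP <- _ _|ab ud duc].
  by rewrite !subrr norm20 mulr0.
set w := u b - u a.
pose g r := dot w (u r).
have gd t : a <= t <= b -> is_derive t (1 : R) g (dot w (du t)).
  by move=> /ud; exact: is_derive_dot.
have [||t] := @MVT _ g (fun t => dot w (du t)) a b ab.
- by move=> t; rewrite in_itv /= => /andP[at_ tb]; apply: gd; rewrite !ltW.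
- exact: derive1_within_continuous gd.
rewrite in_itv /= => atb.
have -> : g b - g a = norm2 w ^+ 2 by rewrite sqr_norm2 -dotBr.
(* If [w = 0], the sign of [c] comes from the speed bound at the intermediate point. *)
move=> ww; have [w0|nw0] := eqVneq (norm2 w) 0.
  rewrite w0 mulr_ge0 ?subr_ge0 ?(ltW ab) //.
  exact: le_trans (norm2_ge0 _) (duc _ atb).
have wp : 0 < norm2 w by rewrite lt_def nw0 norm2_ge0.
rewrite -(ler_pM2l wp) -expr2 ww mulrA ler_wpM2r ?subr_ge0 ?(ltW ab) //.
apply: le_trans (dot_le_norm2 _ _) _.
by rewrite ler_wpM2l ?duc // ltW.
Qed.

(* Let tau be the first time at which the distance to the starting point reaches
   rho. Up to tau the speed is at most rho / h, so at tau < s + h the distance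
   is still below rho. *)
Lemma norm2_barrier u (du : R -> 'cV[R]_n) (s h rho : R) : 0 < h -> 0 < rho ->
  (forall t, s <= t <= s + h -> is_derive t 1 u (du t)) ->
  (forall t, s <= t <= s + h -> norm2 (u t - u s) < rho ->
    h * norm2 (du t) <= rho) ->
  forall t, s <= t <= s + h -> norm2 (u t - u s) <= rho.
Proof.
move=> h0 rho0 ud duh t /andP[st tsh]; rewrite leNgt; apply/negP => rhot.
pose S := [set r | s <= r <= t /\ rho <= norm2 (u r - u s)].
have St : S t by split; rewrite ?st ?lexx // ltW.
have Slb : lbound S s by move=> r [/andP[]].
have Sinf : has_inf S by split; [exists t|exists s].
pose tau := inf S.
have stau : s <= tau by apply: lb_le_inf Slb; exists t.
have tauS r : S r -> tau <= r by exact: (ge_inf Sinf.2).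
have taut : tau <= t by exact: tauS.
have before r : s <= r -> r < tau -> norm2 (u r - u s) < rho.
  move=> sr rtau; rewrite ltNge; apply/negP => rhor.
  have Sr : S r by split=> //; rewrite sr (le_trans (ltW rtau)).
  by move: rtau; rewrite ltNge tauS.
have : norm2 (u tau - u s) <= rho / h * (tau - s).
  apply: (norm2_mvt u du) => // r.
    move=> /andP[sr rtau]; apply: ud.
    by rewrite sr (le_trans rtau (le_trans taut tsh)).
  move=> /andP[sr rtau]; rewrite ler_pdivlMr // mulrC; apply: duh.
    by rewrite !ltW // (lt_le_trans rtau (le_trans taut tsh)).
  by apply: before => //; exact: ltW.
have tauh : rho / h * (t - s) <= rho.
  by rewrite -mulrA ger_pMr // ler_pdivrMl // mulr1 lerBlDl.
have [tauE|ntau] := eqVneq tau t.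
  by rewrite tauE => /le_trans/(_ tauh); rewrite leNgt rhot.
have ltau : tau < t by rewrite lt_neqAle ntau.
have rhoh : 0 < rho / h by rewrite divr_gt0.
move=> htau; have {htau} tau_rho : norm2 (u tau - u s) < rho.
  apply: le_lt_trans htau (lt_le_trans _ tauh).
  by rewrite ltr_pM2l // ltrBlDr subrK.
have wd : is_derive tau 1 (fun r => u r - u s) (du tau).
  rewrite -[du tau]subr0; apply: is_deriveB; apply: ud.
  by rewrite stau (le_trans taut).
(* The squared distance, unlike the distance, is differentiable even where it vanishes. Continuity
   keeps it below [rho ^+ 2] within some [e] of [tau], so [tau + e] would still be a lower bound of
   [S]. *)
have wc := is_derive1_continuous _ _ _ _ (is_derive_dotxx _ _ _ wd).
have : \forall r \near tau, dot (u r - u s) (u r - u s) < rho ^+ 2.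
  apply: (@cvgr_lt _ _ _ _ _ _ wc).
  by rewrite -sqr_norm2 ltr_pXn2r ?nnegrE ?norm2_ge0 // ltW.
move=> /nbhs_ballP[e /= e0 he].
have : tau + e <= tau.
  apply: lb_le_inf; first by exists t.
  move=> r Sr; rewrite leNgt; apply/negP => re.
  have taur : tau <= r by exact: tauS.
  have /he : ball tau e r.
    by rewrite /ball /= distrC ger0_norm ?subr_ge0 // ltrBlDl.
  rewrite /= -sqr_norm2 ltr_pXn2r ?nnegrE ?norm2_ge0 ?(ltW rho0) // ltNge.
  by case: Sr => _ ->.
by rewrite gerDl leNgt e0.
Qed.

(** With the integrating factor [expR (- c * t)], the product has derivative
    [(dg t - c * g t) * expR (- c * t)], which is non-positive; so the sign at [a] persists. *)
Lemma gronwall0 (g dg : R -> R) (a b c : R) :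
  (forall t, a <= t <= b -> is_derive t 1 g (dg t)) ->
  (forall t, a <= t <= b -> dg t <= c * g t) -> g a <= 0 ->
  forall t, a <= t <= b -> g t <= 0.
Proof.
move=> gd dgc ga t /andP[at_ tb].
pose e r := expR (- c * r).
have ed r : is_derive r (1 : R) e (- c * e r).
  have h : is_derive r (1 : R) (fun r => - c * r) (- c).
    have := @is_deriveZ _ _ _ (@id R) (- c) r 1 1 _.
    by rewrite [_%:A]mulr1; apply.
  have := @is_derive1_comp R expR (fun r => - c * r) r _ _ _ h.
  by move/(_ _ (is_derive_expR _)); rewrite mulrC.
have hd r : a <= r <= t -> is_derive r (1 : R) (g * e)
    (g r *: (- c * e r) + e r *: dg r).
  move=> /andP[ar rt]; have rb : a <= r <= b by rewrite ar (le_trans rt tb).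
  exact: is_deriveM (gd r rb) (ed r).
have [||s] := @MVT_segment _ (g * e) (fun r => g r *: (- c * e r) + e r *: dg r)
  a t at_.
- by move=> r; rewrite in_itv /= => /andP[ar rt]; apply: hd; rewrite !ltW.
- exact: derive1_within_continuous hd.
rewrite in_itv /= => /andP[as_ st] eq1.
have : (g * e) t <= 0.
  have -> : (g * e) t = g a * e a + ((g * e) t - (g * e) a).
    by rewrite -[(g * e) a]/(g a * e a); ring.
  rewrite eq1.
  have e1 : 0 < e a by exact: expR_gt0.
  have h1 : g a * e a <= 0 by rewrite pmulr_lle0.
  rewrite -[leRHS]addr0 lerD // mulr_le0_ge0 ?subr_ge0 //.
  have -> : g s *: (- c * e s) + e s *: dg s = e s * (dg s - c * g s).
    by rewrite /GRing.scale /=; ring.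
  rewrite pmulr_rle0 ?expR_gt0 // subr_le0.
  by apply: dgc; rewrite as_ (le_trans st tb).
by rewrite -[(g * e) t]/(g t * e t) pmulr_lle0 // expR_gt0.
Qed.

End Calculus.

(** * Solutions of the differential equation *)

Section Flow.
Context {R : realType} {n : nat}.
Implicit Types (f : R -> 'cV[R]_n -> 'cV[R]_n) (u v : R -> 'cV[R]_n)
  (s t : R) (x y : 'cV[R]_n).

(** Decomposing [x] along the coordinate vectors writes the spatial differential as a matrix of
    directional derivatives, which smoothness makes continuous. *)
Lemma diff_jacobian f (q : R * 'cV[R]_n) x :
  differentiable (fun z : R * 'cV[R]_n => f z.1 z.2) q ->
  'd (fun z : R * 'cV[R]_n => f z.1 z.2) q (0, x) =
  (\matrix_(i, j) 'D_(0, delta_mx j ord0)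
     (fun z : R * 'cV[R]_n => f z.1 z.2) q i ord0) *m x.
Proof.
move=> fd.
have -> : (0, x) = \sum_j x j ord0 *: ((0, delta_mx j ord0) : R * 'cV[R]_n).
  transitivity ((\sum_(j < n) 0 : R),
    \sum_j x j ord0 *: (delta_mx j ord0 : 'cV[R]_n)).
    congr pair; first by rewrite big1.
    rewrite {1}(matrix_sum_delta x); apply: eq_bigr => i _.
    by rewrite big_ord1 ord1.
  elim/big_ind3 : _ => // [x1 x2 x3 y1 y2 y3 <- <- //|j _].
  by congr pair; rewrite /GRing.scale /= mulr0.
rewrite linear_sum; apply/colP => i; rewrite summxE mxE.
apply: eq_bigr => j _.
by rewrite linearZ mxE mxE deriveE // mulrC.
Qed.

(** The map [p] sweeps the segments from [v t] to [u t], starting from the compact rectangle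
    [[a, b]] times [[0, 1]]. There [N], the sum of the norms of the spatial partial derivatives, has
    a maximum, and [n ^ 2] times it bounds the Jacobian; the mean value inequality along each
    segment concludes. *)
Lemma segment_lipschitz f u v (a b : R) :
  smooth (fun z : R * 'cV[R]_n => f z.1 z.2) -> a <= b ->
  (forall t, a <= t <= b -> {for t, continuous u}) ->
  (forall t, a <= t <= b -> {for t, continuous v}) ->
  exists L, forall t, a <= t <= b ->
    norm2 (f t (u t) - f t (v t)) <= L * norm2 (u t - v t).
Proof.
move=> /(_ 1%N)[fd fc] ab uc vc.
pose F (z : R * 'cV[R]_n) := f z.1 z.2.
pose p (z : R * R) : R * 'cV[R]_n :=
  (z.1, v z.1 + z.2 *: (u z.1 - v z.1)).
have pc (z : R * R) : a <= z.1 <= b -> {for z, continuous p}.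
  case: z => [t s] /= tab.
  have c1 : fst z @[z --> (t, s)] --> t by exact: cvg_fst.
  have c2 : snd z @[z --> (t, s)] --> s by exact: cvg_snd.
  have cu : u z.1 @[z --> (t, s)] --> u t.
    exact: (cvg_comp _ _ c1 (uc t tab)).
  have cv : v z.1 @[z --> (t, s)] --> v t.
    exact: (cvg_comp _ _ c1 (vc t tab)).
  apply: (cvg_pair c1 (cvgD cv (cvgZ c2 (cvgB cu cv)))).
pose N := \sum_j (fun z : R * R => `|'D_(0, delta_mx j ord0) F (p z)|).
have Nc (z : R * R) : a <= z.1 <= b -> {for z, continuous N}.
  move=> zab; rewrite /N; elim/big_ind : _ => [|g h gc hc|j _].
  - exact: cvg_cst.
  - exact: continuousD.
  - by apply: cvg_norm; exact: continuous_comp (pc z zab) (fc _ _).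
have [|||[t0 s0] _ Nmax] :=
    @compact_EVT_max _ _ N (`[a, b]%classic `*` `[0, 1]%classic).
- by exists (a, 0); split; rewrite /= in_itv /= lexx ?ab ?ler01.
- exact: compact_setX (@segment_compact _ _ _) (@segment_compact _ _ _).
- apply: continuous_in_subspaceT => z; rewrite inE => -[/= zab _].
  by apply: Nc; move: zab; rewrite in_itv.
exists (n%:R * (n%:R * N (t0, s0))) => t tab.
set w := u t - v t.
pose J s := \matrix_(i, j) 'D_(0, delta_mx j ord0) F (p (t, s)) i ord0.
pose g s := F (p (t, s)).
have gd s : is_derive s (1 : R) g (J s *m w).
  have pd : is_diff s (fun s : R => p (t, s)) (fun h : R => (0, h *: w)).
    apply: (@is_diff_pair _ _ _ _ (cst t) (cst 0) _ _ s).
    rewrite -[X in is_diff _ _ X]add0r.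
    exact: (@is_diffD _ _ _ (cst (v t)) (fun s => s *: w) 0 _ s).
  have gD : is_diff s g ('d F (p (t, s)) \o (fun h : R => (0, h *: w))).
    apply: (@is_diff_comp _ _ _ _ _ _ F _ s pd).
    exact/differentiableP/fd.
  apply: DeriveDef; first exact/diff_derivable/ex_diff.
  by rewrite deriveE ?diff_val /= ?scale1r ?diff_jacobian //; exact: ex_diff.
have -> : f t (u t) - f t (v t) = g 1 - g 0.
  by rewrite /g /F /p /= scale1r scale0r addr0 [v t + _]addrC subrK.
set L := n%:R * _ * norm2 w; have -> : L = L * (1 - 0) by rewrite subr0 mulr1.
apply: (norm2_mvt g (fun s => J s *m w)) => // s /andP[s0_ s1].
apply: norm2_mulmx_entries => i j; rewrite mxE.
have : N (t, s) <= N (t0, s0).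
  by apply: Nmax; rewrite inE; split; rewrite /= in_itv /= ?tab // !ltW.
(* An entry is at most the maximum norm of its column, and this norm is one term of [N]. *)
apply: le_trans; apply: (@le_trans _ _ `|'D_(0, delta_mx j ord0) F (p (t, s))|).
  rewrite [leRHS]/Num.Def.normr /= mx_normrE.
  exact: (le_bigmax _ _ (i, ord0)).
by rewrite /N fct_sumE (bigD1 j) //= lerDl sumr_ge0.
Qed.

Lemma solutionP f s t u : s <= t -> solution f s t u <->
  (forall r, s <= r <= t -> is_derive r 1 u (f r (u r))).
Proof. by move=> st; rewrite /solution min_l // max_r. Qed.

(** By Cauchy-Schwarz and the Lipschitz bound, the derivative of the squared distance of [u] and [v]
    is at most [2 * L] times this squared distance, so [gronwall0] applies. *)
Lemma solution_unique f u v s t :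
  smooth (fun z : R * 'cV[R]_n => f z.1 z.2) -> s <= t ->
  solution f s t u -> solution f s t v -> u s = v s ->
  forall r, s <= r <= t -> u r = v r.
Proof.
move=> fs st /(solutionP _ _ _ _ st) us /(solutionP _ _ _ _ st) vs uvs r rst.
have [||L fL] := segment_lipschitz _ u v s t fs st.
- by move=> q /us; exact: is_derive1_continuous.
- by move=> q /vs; exact: is_derive1_continuous.
apply: subr0_eq; apply: dotxx_eq0; apply: le_anti; rewrite dotxx_ge0 andbT.
pose w := u - v.
have wd q : s <= q <= t -> is_derive q (1 : R) w (f q (u q) - f q (v q)).
  by move=> qst; exact: is_deriveB (us q qst) (vs q qst).
apply: (gronwall0 (fun q => dot (w q) (w q))
  (fun q => 2 * dot (w q) (f q (u q) - f q (v q))) s t (2 * L)) => //.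
- by move=> q /wd; exact: is_derive_dotxx.
- move=> q /fL fq; rewrite -mulrA ler_pM2l // -sqr_norm2.
  apply: le_trans (dot_le_norm2 _ _) _; rewrite expr2 mulrCA.
  by rewrite ler_wpM2l // norm2_ge0.
- by rewrite /w -[(u - v) s]/(u s - v s) uvs subrr -sqr_norm2 norm20 expr0n.
Qed.

(** Each difference quotient of the glued function at [t] is one of [u] or one of [v], and both
    families tend to [l]. *)
Lemma is_derive_glue (V : normedModType R) (u v : R -> V) (t : R) (l : V) :
  u t = v t -> is_derive t 1 u l -> is_derive t 1 v l ->
  is_derive t 1 (fun r => if r <= t then u r else v r) l.
Proof.
move=> uvt [ud ul] [vd vl]; set w := fun r => _.
have wl : h^-1 *: (w (h *: (1 : R) + t) - w t) @[h --> 0^'] --> l.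
  move=> A lA.
  have uA : \forall h \near 0^', A (h^-1 *: (u (h *: (1 : R) + t) - u t)).
    by apply: ud; rewrite -ul in lA.
  have vA : \forall h \near 0^', A (h^-1 *: (v (h *: (1 : R) + t) - v t)).
    by apply: vd; rewrite -vl in lA.
  apply: filterS (filterI uA vA) => h [uAh vAh] /=.
  by rewrite /w lexx; case: ifP => _ //; rewrite uvt.
by apply: DeriveDef; [apply/cvg_ex; exists l|exact: cvg_lim].
Qed.

Lemma flow_to_refl f t x : flow_to f t t x x.
Proof.
(* Even on a one-point interval [solution] asks for a derivative at [t]; the tangent line has the
   right one. *)
exists (fun r => x + (r - t) *: f t x); split; last 2 first.
- by rewrite subrr scale0r addr0.
- by rewrite subrr scale0r addr0.
apply/solutionP => // r /andP[tr rt].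
have -> : r = t by apply/le_anti/andP.
rewrite subrr scale0r addr0.
have h : is_diff t (fun r => x + (r - t) *: f t x) (fun h => h *: f t x).
  rewrite -[X in is_diff _ _ X]add0r.
  apply: (@is_diffD _ _ _ (cst x) _ 0 _ t).
  have h1 : is_diff t (fun r => r - t) id.
    rewrite -[X in is_diff _ _ X]subr0.
    exact: (@is_diffB _ _ _ id (cst t) id 0 t).
  exact: (is_diff_comp h1 (is_diff_scalel (t - t) (f t x))).
apply: DeriveDef; first exact/diff_derivable/ex_diff.
by rewrite deriveE ?diff_val ?scale1r //; exact: ex_diff.
Qed.

(** The concatenation agrees with [u] or with [v] near every time other than [t]; at [t] both have
    derivative [f t y], so [is_derive_glue] applies. *)
Lemma flow_to_trans f s t (r : R) x y (z : 'cV[R]_n) : s <= t -> t <= r ->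
  flow_to f s t x y -> flow_to f t r y z -> flow_to f s r x z.
Proof.
move=> st tr [u [/(solutionP _ _ _ _ st) us ux uy]].
move=> [v [/(solutionP _ _ _ _ tr) vs vy vz]].
have uvt : u t = v t by rewrite uy vy.
pose w q := if q <= t then u q else v q.
exists w; split; last 2 first.
- by rewrite /w st.
(* When [r = t] the concatenation takes its final value from [u], which agrees with [v] there. *)
- rewrite /w; case: ifPn => // rt.
  have rE : r = t by apply/le_anti/andP.
  by rewrite -vz rE uvt.
apply/solutionP; first exact: le_trans tr.
move=> q /andP[sq qr]; have [qt|tq|->] := ltgtP q t.
- have uq : is_derive q 1 u (f q (u q)) by apply: us; rewrite sq ltW.
  rewrite /w (ltW qt).
  apply: (@near_eq_is_derive _ _ _ u) => //.
  near=> h; rewrite /w ifT //.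
  by apply/ltW; near: h; exact: lt_nbhsl.
- have vq : is_derive q 1 v (f q (v q)) by apply: vs; rewrite qr ltW.
  rewrite /w leNgt tq /=.
  apply: (@near_eq_is_derive _ _ _ v) => //.
  near=> h; rewrite /w ifF //; apply/negbTE; rewrite -ltNge.
  by near: h; exact: lt_nbhsr.
- rewrite {2}/w lexx; apply: is_derive_glue => //.
    by apply: us; rewrite st lexx.
  by rewrite uvt; apply: vs; rewrite tr lexx.
Unshelve. all: by end_near. Qed.

Lemma solution_flow_to f s t (r : R) x u : s <= r -> r <= t ->
  solution f s t u -> u s = x -> flow_to f s r x (u r).
Proof.
move=> sr rt us ux; exists u; split => //; apply/solutionP => // q /andP[sq qr].
by apply: (solutionP _ _ _ _ (le_trans sr rt)).1 => //; rewrite sq (le_trans qr).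
Qed.

(** Uniqueness makes the choice by [xget] harmless; its default is excluded because [y] is a
    candidate. *)
Lemma flow_toE f s t x y :
  smooth (fun z : R * 'cV[R]_n => f z.1 z.2) -> s <= t ->
  flow_to f s t x y -> flow f s t x = y.
Proof.
move=> fs st xy; rewrite /flow; case: xgetP => [z _ xz|/(_ y)//].
have [u [us ux uy]] := xy; have [v [vs vx vz]] := xz.
rewrite -uy -vz; apply/esym/(solution_unique f u v s t) => //.
  by rewrite ux vx.
by rewrite st lexx.
Qed.

End Flow.

(** * One step of the algorithm *)

Section Stretching.
Context {R : realType} {n : nat}.
Implicit Types (A M G : 'M[R]_n) (x y : 'cV[R]_n) (E : set 'M[R]_n).

(** A non-zero kernel vector would annihilate the quadratic form. This starts the invariant that the
    factors are invertible. *)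
Lemma sym_posdef_unitmx M : sym_posdef M -> M \in unitmx.
Proof.
move=> [_ Mpos]; rewrite -row_free_unit -kermx_eq0; apply/negPn/negP.
case/rowV0Pn => v /sub_kermxP vM v0.
have := Mpos v^T; rewrite trmx_eq0 => /(_ v0).
by rewrite /qform trmxK vM mul0mx mxE ltxx.
Qed.

Lemma factor_unitmx A : A^T *m A \in unitmx -> A \in unitmx.
Proof. by rewrite unitmx_mul => /andP[]. Qed.

(** Inserting [invmx A *m A] in front of [y - x] makes the derivative of [A' *m g] along the segment
    a matrix [A' *m G *m invmx A] applied to [A *m (y - x)]. Since [norm2_mvt] asks for a bound at
    each point only, [E] may be non-convex. *)
Lemma stretching_mvt (g : 'cV[R]_n -> 'cV[R]_n) A A' E x y L : A \in unitmx ->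
  (forall s : R, 0 <= s <= 1 ->
    exists2 G, E G & is_diff (x + s *: (y - x)) g (mulmx G)) ->
  (forall G, E G -> opnorm2 (A' *m G *m invmx A) <= L) ->
  norm2 (A' *m (g y - g x)) <= L * norm2 (A *m (y - x)).
Proof.
move=> Au gd EL; pose p (s : R) := x + s *: (y - x).
pose du s := A' *m 'd g (p s) (y - x).
have pd (s : R) : is_diff s p (fun h => h *: (y - x)).
  rewrite -[X in is_diff _ _ X]add0r.
  exact: (is_diffD (is_diff_cst x s) (is_diff_scalel s (y - x))).
have ud (s : R) : 0 <= s <= 1 -> is_derive s 1 (fun s => A' *m g (p s)) (du s).
  move=> /gd[G _ gG]; apply: is_derive_mulmx.
  have gp : is_diff s (g \o p) (mulmx G \o (fun h => h *: (y - x))).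
    exact: is_diff_comp.
  apply: DeriveDef; first exact/diff_derivable/ex_diff.
  by rewrite deriveE ?diff_val /= ?scale1r //; exact: ex_diff.
have p1 : p 1 = y by rewrite /p scale1r [x + _]addrC subrK.
have p0 : p 0 = x by rewrite /p scale0r addr0.
set c := L * _; have -> : c = c * (1 - 0) by rewrite subr0 mulr1.
rewrite -{1}p1 -{1}p0 mulmxBr.
apply: (norm2_mvt (fun s => A' *m g (p s)) du _ _ c ler01 ud).
move=> s /andP[s0 s1]; have [|G EG gG] := gd s; first by rewrite !ltW.
rewrite /du diff_val.
have -> : A' *m (G *m (y - x)) = A' *m G *m invmx A *m (A *m (y - x)).
  by rewrite !mulmxA mulmxKV.
apply: le_trans (norm2_mulmx_le _ _) _.
by rewrite ler_wpM2r ?norm2_ge0 ?EL.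
Qed.

(** Keeps the segment of [stretching_mvt] inside the ball where the gradients are enclosed. *)
Lemma mball_segment M x y (r s : R) : mball M x r y -> 0 <= s <= 1 ->
  mball M x r (x + s *: (y - x)).
Proof.
rewrite /mball /= => yr /andP[s0 s1].
have -> : mnorm M (x + s *: (y - x) - x) = s * mnorm M (y - x).
  rewrite [x + _]addrC addrK /mnorm /qform -scalemxAr.
  have -> : (s *: (y - x))^T = s *: (y - x)^T by exact: linearZ.
  rewrite -!scalemxAl scalerA mxE sqrtrM ?mulr_ge0 //.
  by rewrite -expr2 sqrtr_sqr ger0_norm.
by apply: le_trans yr; rewrite ler_piMl // sqrtr_ge0.
Qed.

End Stretching.

Section Step.
Context {R : realType} {n : nat}.
Variables (f : R -> 'cV[R]_n -> 'cV[R]_n) (tl : clrt_tools R n).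
Variables (eps Cdelta CM : R).
Hypothesis fsmooth : smooth (fun z : R * 'cV[R]_n => f z.1 z.2).
Implicit Types d : clrt_data R n.

(** Invertibility belongs to the invariant because only then is [invmx] a true inverse in the
    stretching bound. *)
Definition factored d : Prop :=
  metric d = (Defs.factor d)^T *m Defs.factor d /\ Defs.factor d \in unitmx.

Lemma step_time_incr d d' : 0 < incr d -> step_time tl eps d d' ->
  0 < incr d' /\ time d' = time d + incr d'.
Proof.
move=> d0 [m [_ _ hd' td']]; split=> //; rewrite hd'.
by apply: divr_gt0 => //; apply: exprn_gt0.
Qed.

(** The new factor is an arbitrary one of the new metric, so its invertibility is read off from that
    metric, both when it is kept and when it is [Ahat^T *m Ahat]. *)
Lemma step_tube_factored d d' :
  factored d -> step_tube f tl CM d d' -> factored d'.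
Proof.
move=> [dM du] [Fj [E [Ahat [L /= [_ _ [_ [Au _]] [mE mF] _]]]]].
split=> //; apply: factor_unitmx; rewrite -mF mE.
by case: ifP => _; rewrite ?dM unitmx_mul unitmx_tr ?Au ?du.
Qed.

(** Existence up to [time d'] is part of the gradient enclosure. For [y] in the ball around [x], the
    image of [x] is the new centre, and [stretching_mvt] bounds the new distance by [radius d']. *)
Lemma step_tube_flow d d' y : tools_conservative f tl -> factored d ->
  time d <= time d' -> step_tube f tl CM d d' -> data_tube d y ->
  exists2 z, flow_to f (time d) (time d') y z & data_tube d' z.
Proof.
move=> [toolP _] dfac tt' dd' dy; have d'fac := step_tube_factored _ _ dfac dd'.
case: dd' => [Fj [E [Ahat [L /= [[_ boxd'] toolFj _ _ [L0 FjL rE]]]]]].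
have [_ Fjflow] := toolP _ _ _ _ toolFj.
have [[z yz] _] := Fjflow _ dy; exists z => //.
have <- := flow_toE _ _ _ _ _ fsmooth tt' yz.
have [x bx xy] := dy.
exists (flow f (time d) (time d') x); first by apply: boxd'; exists x.
have [[dM du] [d'M _]] := (dfac, d'fac).
move: (xy); rewrite /mball /= dM d'M !mnorm_factor rE => xyr.
apply: le_trans (_ : L * norm2 (Defs.factor d *m (y - x)) <= _); last first.
  by rewrite ler_pM2l.
apply: stretching_mvt FjL => // s s01.
have [|_ //] := Fjflow (x + s *: (y - x)).
by exists x => //; exact: mball_segment.
Qed.

(** [norm2_barrier] is applied to [factor d *m u]: while this is within [rho] of its start, the
    triangle inequality keeps [u] in the tube of radius [Delta], where [UNSAT] bounds the increment
    times the speed by [rho]. *)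
Lemma step_output_tube d d' Delta y u t : 1 < Cdelta -> solver_sound f tl ->
  factored d -> 0 < incr d' -> time d' = time d + incr d' ->
  step_output tl Cdelta d d' Delta -> data_tube d y ->
  solution f (time d) (time d') u -> u (time d) = y ->
  time d <= t <= time d' -> mtube (metric d) (box d) Delta (u t).
Proof.
move=> C1 sound [dM du] h0 tE [guess [m /= [g0 _ unsat ->]]] [x bx xy].
rewrite solutionP ?tE ?lerDl ?(ltW h0) // => us uy tt.
(* The enlarged guess at which the solver answers [UNSAT]: [Delta] is the radius of [d] plus
   [rho]. *)
set rho := Cdelta ^+ m * guess.
have rho0 : 0 < rho by rewrite mulr_gt0 // exprn_gt0 // (lt_trans ltr01).
have xyr : norm2 (Defs.factor d *m (y - x)) <= Defs.radius d.
  by move: xy; rewrite /mball /= dM mnorm_factor.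
have near_x (z : 'cV[R]_n) : norm2 (Defs.factor d *m (z - y)) <= rho ->
    mtube (metric d) (box d) (Defs.radius d + rho) z.
  move=> zrho; exists x => //; rewrite /mball /= dM mnorm_factor.
  have -> : z - x = (y - x) + (z - y) by rewrite [RHS]addrC subrKA.
  by rewrite mulmxDr (le_trans (norm2D _ _)) // lerD.
apply: (near_x (u t)); rewrite -uy mulmxBr.
pose v r := Defs.factor d *m u r; pose dv r := Defs.factor d *m f r (u r).
apply: (norm2_barrier v dv _ _ _ h0 rho0) tt.
  by move=> r /us; exact: is_derive_mulmx.
(* A point of excessive speed would be a witness for the query, at the elapsed time [r - time d]. *)
move=> r /andP[tr rt] vr; rewrite leNgt; apply/negP => fast.
apply: (sound _ unsat); exists (u r), (r - time d); split => /=.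
- by apply: near_x; rewrite -uy mulmxBr ltW.
- by rewrite subr_ge0 tr lerBlDl.
rewrite [time d + _]addrC subrK dM mnorm_factor -scalemxAr norm2Z.
by rewrite gtr0_norm // [ltLHS]addrC addKr.
Qed.

End Step.

(** * Induction over the steps of the algorithm *)

Theorem proposition1 (R : realType) (n : nat)
    (f : R -> 'cV[R]_n -> 'cV[R]_n) (tl : clrt_tools R n)
    (eps Cdelta CM : R) (t0 T h0 : R) (M0 : 'M[R]_n) (X0 : set 'cV[R]_n)
    (delta0 : R) (k : nat) (d : nat -> clrt_data R n) (Delta : nat -> R)
    (hf : smooth (fun z : R * 'cV[R]_n => f z.1 z.2))
    (heps : 0 < eps) (hCdelta : 1 < Cdelta) (hCM : 0 < CM)
    (hh0 : 0 < h0) (hM0 : sym_posdef M0) (hX0 : is_box X0)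
    (hdelta0 : 0 < delta0)
    (htools : tools_conservative f tl) (hsolver : solver_sound f tl)
    (hrun : clrt_run f tl eps Cdelta CM t0 T h0 M0 X0 delta0 k d Delta)
    (hT : time (d k) = T) :
  forall j : nat, (j < k)%N ->
    reach f t0 (mtube M0 X0 delta0) (time (d j)) (time (d j.+1))
      `<=` mtube (metric (d j)) (box (d j)) (Delta j).
Proof.
case: hrun => [[t0E h0E X0E delta0E] [M0E M0F] steps _ _].
(* Stated with [flow_to], as [flow] alone would not record that the solution exists up to
   [time (d j)]. *)
have invariant j : (j <= k)%N ->
    [/\ factored (d j), 0 < incr (d j), t0 <= time (d j) &
      forall x, mtube M0 X0 delta0 x ->
        exists2 y, flow_to f t0 (time (d j)) x y & data_tube (d j) y].
  elim: j => [_|j IH jk].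
    split; [|by rewrite h0E|by rewrite t0E|move=> x Xx].
      split; first by rewrite M0E.
      by apply: factor_unitmx; rewrite -M0F; exact: sym_posdef_unitmx.
    by exists x; [rewrite t0E; exact: flow_to_refl|
                  rewrite /data_tube M0E X0E delta0E].
  have [fac h_gt0 t0j tube] := IH (ltnW jk).
  have [stime stube _] := steps _ jk.
  have [h'_gt0 tE] := step_time_incr _ _ _ _ h_gt0 stime.
  have tj : time (d j) <= time (d j.+1) by rewrite tE lerDl ltW.
  split=> //.
  - exact: step_tube_factored stube.
  - exact: le_trans tj.
  move=> x /tube[y xy dy].
  have [z yz dz] := step_tube_flow _ _ _ hf _ _ _ htools fac tj stube dy.
  by exists z => //; exact: flow_to_trans xy yz.
move=> j jk _ [x [t [/= Xx tjt ->]]].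
have [fac h_gt0 t0j /(_ x Xx)[y xy dy]] := invariant j (ltnW jk).
have [stime stube sout] := steps _ jk.
have [h'_gt0 tE] := step_time_incr _ _ _ _ h_gt0 stime.
have tj : time (d j) <= time (d j.+1) by rewrite tE lerDl ltW.
(* A solution [u] exists over the whole step; its restriction to the times from [time (d j)] to [t]
   continues the one from [x], so [flow f t0 t x] is [u t]. *)
have [z [u [us uy _]] _] :=
  step_tube_flow _ _ _ hf _ _ _ htools fac tj stube dy.
have [tjt1 tjt2] := andP tjt.
have yt := solution_flow_to _ _ _ _ _ _ tjt1 tjt2 us uy.
rewrite (flow_toE _ _ _ _ _ hf _ (flow_to_trans _ _ _ _ _ _ _ t0j tjt1 xy yt)).
  exact: (step_output_tube _ _ _ _ _ _ _ _ _ hCdelta hsolver fac h'_gt0 tE sout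
    dy).
exact: le_trans tjt1.
Qed.
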